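(* Let $\kappa \ge 1$ and let $\epsilon_T$ satisfy $0<\epsilon_T<3\kappa$. Set $$y_{\max} = \kappa\sqrt{2\ln\!\left(\tfrac{3\kappa}{\epsilon_T}\right)},\qquad z_{\max} = \sqrt{2\ln\!\left(\tfrac{3\kappa}{\epsilon_T}\right)}.$$ Then $$\sup_{x\in\mathcal{D}_\kappa}\left|\frac{i}{\sqrt{2\pi}}\int_0^{y_{\max}}dy\int_{-z_{\max}}^{z_{\max}}dz\; z e^{-z^2/2}e^{-ixyz} \;-\; \frac{1}{x}\right| \le \epsilon_T ,$$ where $\mathcal{D}_\kappa=[-1,-1/\kappa]\cup[1/\kappa,1]$.
   Context: For $x\neq 0$ one has the integral representation $x^{-1} = \frac{i}{\sqrt{2\pi}}\int_0^\infty dy\int_{-\infty}^{\infty}dz\, z e^{-z^2/2}e^{-ixyz}$; the displayed double integral with finite limits $y_{\max},z_{\max}>0$ is its truncation. *)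

(* Defs.v *)
From Stdlib Require Import Reals.
From Coquelicot Require Import Coquelicot.
Open Scope R_scope.

Definition cexpi (t : R) : C := (cos t, sin t).

Definition D_kappa (kappa x : R) : Prop :=
  (-1 <= x <= - / kappa) \/ (/ kappa <= x <= 1).

Definition integrand (x y z : R) : C :=
  Cmult (RtoC (z * exp (- (z ^ 2) / 2))) (cexpi (- (x * y * z))).

Definition trunc_inv (ymax zmax x : R) : C :=
  Cmult (Cmult Ci (RtoC (/ sqrt (2 * PI))))
    (RInt (V := C_R_CompleteNormedModule)
       (fun y => RInt (V := C_R_CompleteNormedModule)
                   (fun z => integrand x y z) (- zmax) zmax) 0 ymax).

(* Main.v *)
(* With G(t) = int_{-Z}^{Z} exp(-z^2/2) cos(tz) dz, the inner integral over z
   is i G'(xy), so the truncation equals (G(0) - G(xY)) / (x sqrt(2 pi)), and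
   it remains to see that G(0) is close to sqrt(2 pi) and G(xY) to 0.  Let
   E = exp(-Z^2/2).
   - G(0) = 2 I(Z) with I(t) = int_0^t exp(-z^2/2) dz, and
     I(t)^2 + int_0^1 2 exp(-t^2 (1+u^2)/2) / (1+u^2) du is constant, equal to
     pi/2; hence sqrt(2 pi) (1 - E) <= G(0) <= sqrt(2 pi).
   - Integration by parts gives G' = 2 E sin(tZ) - t G, and comparison with an
     explicit supersolution gives |G(t)| <= sqrt(2 pi) exp(-t^2/2) + 2 E.
   As |x| Y >= Z and E = epsT / (3 kappa), the error is at most
   (1/|x|) 3 E <= epsT. *)

Require Import Defs.
From Stdlib Require Import Reals.
From Coquelicot Require Import Coquelicot.
From Stdlib Require Import Lra.
Open Scope R_scope.

(** * General facts on integrals and derivatives *)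

Lemma RInt_odd (f : R -> R) (a : R) :
  (forall x, continuous f x) -> (forall x, f (- x) = - f x) ->
  RInt f (- a) a = 0.
Proof.
  intros cf odd_f.
  assert (ex : forall u v, ex_RInt f u v)
    by (intros; apply (ex_RInt_continuous f); intros; apply cf).
  (* Substituting [- x] for [x] shows that the integral equals its own negative. *)
  assert (H := is_RInt_comp_opp f (- a) a _
                 (RInt_correct f (- - a) (- a) (ex _ _))).
  apply (is_RInt_unique (V := R_CompleteNormedModule)) in H.
  rewrite (RInt_ext _ f) in H.
  2:{ intros x _. rewrite odd_f. apply Ropp_involutive. }
  rewrite Ropp_involutive, <- (opp_RInt_swap f (- a) a) in H by apply ex.
  unfold opp in *; simpl in *. lra.
Qed.

Lemma RInt_even (f : R -> R) (a : R) :
  (forall x, continuous f x) -> (forall x, f (- x) = f x) ->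
  RInt f (- a) a = 2 * RInt f 0 a.
Proof.
  intros cf even_f.
  assert (ex : forall u v, ex_RInt f u v)
    by (intros; apply (ex_RInt_continuous f); intros; apply cf).
  assert (H := is_RInt_comp_opp f 0 a _ (RInt_correct f (- 0) (- a) (ex _ _))).
  apply (is_RInt_unique (V := R_CompleteNormedModule)) in H.
  rewrite (RInt_ext _ (fun x => opp (f x))) in H.
  2:{ intros x _. now rewrite even_f. }
  rewrite (RInt_opp (V := R_CompleteNormedModule)) in H by apply ex.
  rewrite Ropp_0, <- (opp_RInt_swap f (- a) 0) in H by apply ex.
  rewrite <- (RInt_Chasles f (- a) 0 a) by apply ex.
  unfold opp, plus in *; simpl in *. lra.
Qed.

(** Global hypotheses and an explicit partial derivative [df] settle the local side conditions of
    [is_derive_RInt_param] once and for all. *)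
Lemma is_derive_RInt_param_global (f df : R -> R -> R) (a b x : R) :
  (forall u t, is_derive (fun v => f v t) u (df u t)) ->
  (forall u t, continuity_2d_pt df u t) ->
  (forall u t, ex_derive (f u) t) ->
  is_derive (fun u => RInt (f u) a b) x (RInt (df x) a b).
Proof.
  intros Hd Hc He.
  rewrite (RInt_ext (df x) (fun t => Derive (fun u => f u t) x)).
  2:{ intros t _. symmetry. apply is_derive_unique, Hd. }
  apply (is_derive_RInt_param f).
  - apply filter_forall. intros u t _. eexists. apply Hd.
  - intros t _. apply continuity_2d_pt_ext with df; [|apply Hc].
    intros u v. symmetry. apply is_derive_unique, Hd.
  - apply filter_forall. intros u.
    apply (ex_RInt_continuous (f u)). intros t _.
    apply (ex_derive_continuous (f u)), He.
Qed.

Lemma derive_nonneg_le (f df : R -> R) (a b : R) :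
  a <= b ->
  (forall x, a <= x <= b -> is_derive f x (df x)) ->
  (forall x, a <= x <= b -> 0 <= df x) ->
  f a <= f b.
Proof.
  intros ab Hd Hp.
  destruct (MVT_gen f a b df) as [c [Hc E]];
    rewrite ?Rmin_left, ?Rmax_right in * by lra.
  - intros; apply Hd; lra.
  - intros x Hx. apply continuity_pt_filterlim, (ex_derive_continuous f).
    eexists; apply Hd; lra.
  - specialize (Hp c Hc). nra.
Qed.

(** * The Gaussian *)

Definition gauss (z : R) : R := exp (- (z ^ 2) / 2).

Lemma is_derive_gauss (z : R) : is_derive gauss z (- z * gauss z).
Proof. unfold gauss. auto_derive; [easy|]. unfold Rdiv. simpl. field. Qed.

Lemma ex_derive_gauss (z : R) : ex_derive gauss z.
Proof. eexists; apply is_derive_gauss. Qed.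

Lemma Derive_gauss (z : R) : Derive gauss z = - z * gauss z.
Proof. apply is_derive_unique, is_derive_gauss. Qed.

Lemma continuous_gauss (z : R) : continuous gauss z.
Proof. apply (ex_derive_continuous gauss), ex_derive_gauss. Qed.

Lemma gauss_even (z : R) : gauss (- z) = gauss z.
Proof. unfold gauss. f_equal. field. Qed.

Lemma gauss_pos (z : R) : 0 < gauss z.
Proof. apply exp_pos. Qed.

Lemma ex_RInt_gauss (a b : R) : ex_RInt gauss a b.
Proof. apply (ex_RInt_continuous gauss). intros; apply continuous_gauss. Qed.

Lemma gauss_le (z t : R) : 0 <= z <= Rabs t -> gauss t <= gauss z.
Proof.
  intros H. unfold gauss.
  assert (z ^ 2 <= t ^ 2) by (rewrite <- (pow2_abs t); apply pow_incr; lra).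
  destruct (Rle_lt_or_eq_dec (z ^ 2) (t ^ 2)) as [lt | ->]; [easy | | lra].
  apply Rlt_le, exp_increasing. lra.
Qed.

(** * The Gaussian integral over a finite interval *)

Definition polar_remainder (t : R) : R :=
  RInt (fun u => 2 * gauss t * gauss (t * u) / (1 + u ^ 2)) 0 1.

Ltac continuity_2d :=
  repeat first
    [ apply continuity_2d_pt_id1 | apply continuity_2d_pt_id2
    | apply continuity_2d_pt_const
    | apply continuity_2d_pt_mult | apply continuity_2d_pt_plus
    | apply continuity_2d_pt_opp ].

(** Under the integral sign, differentiating the exponent in [t] produces a factor [1 + u ^ 2] that
    cancels the denominator; the substitution [v = t * u] then yields [RInt gauss 0 t]. *)
Lemma is_derive_polar_remainder (t : R) :
  is_derive polar_remainder t (- 2 * gauss t * RInt gauss 0 t).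
Proof.
  replace (- 2 * gauss t * RInt gauss 0 t) with
    (RInt (fun u => - 2 * gauss t * (t * gauss (t * u))) 0 1).
  - apply (is_derive_RInt_param_global
      (fun t u => 2 * gauss t * gauss (t * u) / (1 + u ^ 2))
      (fun t u => - 2 * gauss t * (t * gauss (t * u)))).
    + intros u v. auto_derive.
      * repeat split; apply ex_derive_gauss.
      * rewrite !Derive_gauss. field. nra.
    + intros u v. continuity_2d.
      * apply (continuity_1d_2d_pt_comp gauss (fun u _ => u));
          [apply continuity_pt_filterlim, continuous_gauss | continuity_2d].
      * apply (continuity_1d_2d_pt_comp gauss (fun u v => u * v));
          [apply continuity_pt_filterlim, continuous_gauss | continuity_2d].
    + intros u v. unfold gauss. auto_derive. nra.
  - transitivity (- 2 * gauss t * RInt (fun u => t * gauss (t * u)) 0 1).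
    + apply (RInt_scal (V := R_CompleteNormedModule)
        (fun u => t * gauss (t * u))).
      apply (ex_RInt_continuous (V := R_CompleteNormedModule)). intros.
      apply (ex_derive_continuous (fun u => t * gauss (t * u))).
      unfold gauss. auto_derive. easy.
    + f_equal.
      rewrite (RInt_ext _ (fun u => t * gauss (t * u + 0)))
        by (intros; now rewrite Rplus_0_r).
      etransitivity.
      * apply (RInt_comp_lin (V := R_CompleteNormedModule) gauss t 0 0 1),
          ex_RInt_gauss.
      * f_equal; ring.
Qed.

Lemma Derive_polar_remainder (t : R) :
  Derive polar_remainder t = - 2 * gauss t * RInt gauss 0 t.
Proof. apply is_derive_unique, is_derive_polar_remainder. Qed.

Lemma polar_remainder_0 : polar_remainder 0 = PI / 2.
Proof.
  unfold polar_remainder.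
  replace (PI / 2) with (2 * atan 1 - 2 * atan 0)
    by (rewrite atan_1, atan_0; field).
  apply is_RInt_unique.
  apply (is_RInt_derive (fun u => 2 * atan u)).
  - intros u _. auto_derive; [easy|]. unfold gauss.
    replace (- 0 ^ 2 / 2) with 0 by field.
    replace (- (0 * u) ^ 2 / 2) with 0 by field.
    rewrite exp_0. unfold Rsqr. field. nra.
  - intros u _.
    apply (ex_derive_continuous
      (fun u => 2 * gauss 0 * gauss (0 * u) / (1 + u ^ 2))).
    unfold gauss. auto_derive. nra.
Qed.

(** The derivatives of the two summands cancel, so the sum keeps its value at 0, where only
    [polar_remainder_0] contributes. *)
Lemma RInt_gauss_sqr (t : R) :
  0 < t -> RInt gauss 0 t ^ 2 + polar_remainder t = PI / 2.
Proof.
  intros Ht. rewrite <- polar_remainder_0.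
  transitivity (RInt gauss 0 0 ^ 2 + polar_remainder 0).
  2:{ rewrite RInt_point. unfold zero; simpl. ring. }
  symmetry.
  apply (eq_is_derive (fun t => RInt gauss 0 t ^ 2 + polar_remainder t) 0 t);
    [| easy].
  intros s _.
  auto_derive.
  - repeat split; [apply ex_RInt_gauss | | eexists; apply is_derive_polar_remainder].
    apply filter_forall. intros r.
    apply continuity_pt_filterlim, continuous_gauss.
  - rewrite Derive_polar_remainder.
    change (RInt (fun x => gauss x) 0 s) with (RInt gauss 0 s).
    unfold zero; simpl. ring.
Qed.

Lemma ex_RInt_polar (t a b : R) :
  ex_RInt (fun u => 2 * gauss t * gauss (t * u) / (1 + u ^ 2)) a b.
Proof.
  apply (ex_RInt_continuous (V := R_CompleteNormedModule)). intros u _.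
  apply (ex_derive_continuous
    (fun u => 2 * gauss t * gauss (t * u) / (1 + u ^ 2))).
  unfold gauss. auto_derive. nra.
Qed.

Lemma gauss_0 : gauss 0 = 1.
Proof. unfold gauss. rewrite <- exp_0. f_equal. field. Qed.

Lemma gauss_le_1 (z : R) : gauss z <= 1.
Proof. rewrite <- gauss_0. apply gauss_le. split; [lra | apply Rabs_pos]. Qed.

(** Since [gauss (t * u) <= 1], the integrand is at most [gauss t] times the integrand at [t = 0],
    whose integral is [PI / 2]. *)
Lemma polar_remainder_bounds (t : R) :
  0 <= polar_remainder t <= PI / 2 * gauss t.
Proof.
  assert (P := gauss_pos t).
  split.
  - apply RInt_ge_0; [lra | apply ex_RInt_polar |].
    intros u _. assert (Q := gauss_pos (t * u)).
    apply Rdiv_le_0_compat; nra.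
  - rewrite <- polar_remainder_0, Rmult_comm. unfold polar_remainder.
    rewrite <- (RInt_scal (V := R_CompleteNormedModule)) by apply ex_RInt_polar.
    apply RInt_le; [lra | apply ex_RInt_polar | |].
    + apply (ex_RInt_scal (V := R_NormedModule)), ex_RInt_polar.
    + intros u _.
      change (2 * gauss t * gauss (t * u) / (1 + u ^ 2) <=
              gauss t * (2 * gauss 0 * gauss (0 * u) / (1 + u ^ 2))).
      rewrite Rmult_0_l, !gauss_0.
      replace (gauss t * (2 * 1 * 1 / (1 + u ^ 2)))
        with (2 * gauss t / (1 + u ^ 2)) by (field; nra).
      apply Rmult_le_compat_r.
      * apply Rlt_le, Rinv_0_lt_compat. nra.
      * assert (Q := gauss_le_1 (t * u)). nra.
Qed.

(** * The truncated Fourier transform of the Gaussian *)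

Definition trunc_fourier (Z t : R) : R :=
  RInt (fun z => gauss z * cos (t * z)) (- Z) Z.

Lemma continuous_gauss_cos (t z : R) :
  continuous (fun z => gauss z * cos (t * z)) z.
Proof.
  apply (ex_derive_continuous (fun z => gauss z * cos (t * z))).
  unfold gauss. auto_derive. easy.
Qed.

Lemma continuous_gauss_sin (t z : R) :
  continuous (fun z => z * gauss z * sin (t * z)) z.
Proof.
  apply (ex_derive_continuous (fun z => z * gauss z * sin (t * z))).
  unfold gauss. auto_derive. easy.
Qed.

Lemma ex_RInt_gauss_cos (t a b : R) :
  ex_RInt (fun z => gauss z * cos (t * z)) a b.
Proof.
  apply (ex_RInt_continuous (V := R_CompleteNormedModule)).
  intros; apply continuous_gauss_cos.
Qed.

Lemma ex_RInt_gauss_sin (t a b : R) :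
  ex_RInt (fun z => z * gauss z * sin (t * z)) a b.
Proof.
  apply (ex_RInt_continuous (V := R_CompleteNormedModule)).
  intros; apply continuous_gauss_sin.
Qed.

Lemma is_derive_trunc_fourier (Z t : R) :
  is_derive (trunc_fourier Z) t
    (- RInt (fun z => z * gauss z * sin (t * z)) (- Z) Z).
Proof.
  rewrite <- (RInt_opp (V := R_CompleteNormedModule)) by apply ex_RInt_gauss_sin.
  apply (is_derive_RInt_param_global
    (fun t z => gauss z * cos (t * z))
    (fun t z => - (z * gauss z * sin (t * z)))).
  - intros u z. auto_derive; [easy|]. ring.
  - intros u z. continuity_2d.
    + apply (continuity_1d_2d_pt_comp gauss (fun _ v => v));
        [apply continuity_pt_filterlim, continuous_gauss | continuity_2d].
    + apply (continuity_1d_2d_pt_comp sin (fun u v => u * v));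
        [apply continuity_sin | continuity_2d].
  - intros u z. unfold gauss. auto_derive. easy.
Qed.

(** Integration by parts: the derivative of [gauss z * sin (t * z)] is integrated, and its two
    boundary terms add up because [gauss] is even and [sin] is odd. *)
Lemma RInt_gauss_sin (Z t : R) :
  RInt (fun z => z * gauss z * sin (t * z)) (- Z) Z =
  t * trunc_fourier Z t - 2 * gauss Z * sin (t * Z).
Proof.
  assert (H : is_RInt (fun z => t * (gauss z * cos (t * z))
                                - z * gauss z * sin (t * z)) (- Z) Z
                (gauss Z * sin (t * Z) - gauss (- Z) * sin (t * - Z))).
  { apply (is_RInt_derive (fun z => gauss z * sin (t * z))).
    - intros z _. auto_derive; [repeat split; apply ex_derive_gauss |].
      rewrite Derive_gauss. ring.
    - intros z _.
      apply (ex_derive_continuous (fun z => t * (gauss z * cos (t * z))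
                                - z * gauss z * sin (t * z))).
      unfold gauss. auto_derive. easy. }
  apply (is_RInt_unique (V := R_CompleteNormedModule)) in H.
  rewrite (RInt_minus (V := R_CompleteNormedModule)
    (fun z => t * (gauss z * cos (t * z)))) in H.
  2:{ apply (ex_RInt_scal (V := R_NormedModule)
        (fun z => gauss z * cos (t * z))), ex_RInt_gauss_cos. }
  2:{ apply ex_RInt_gauss_sin. }
  replace (RInt (fun z => t * (gauss z * cos (t * z))) (- Z) Z)
    with (t * trunc_fourier Z t) in H.
  2:{ symmetry. apply (RInt_scal (V := R_CompleteNormedModule)
        (fun z => gauss z * cos (t * z))), ex_RInt_gauss_cos. }
  rewrite gauss_even in H.
  replace (t * - Z) with (- (t * Z)) in H by ring. rewrite sin_neg in H.
  unfold minus, plus, opp, scal in H; simpl in H; unfold mult in H; simpl in H.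
  lra.
Qed.

Lemma Derive_trunc_fourier (Z t : R) :
  Derive (trunc_fourier Z) t =
  - RInt (fun z => z * gauss z * sin (t * z)) (- Z) Z.
Proof. apply is_derive_unique, is_derive_trunc_fourier. Qed.

Lemma ex_derive_trunc_fourier (Z t : R) : ex_derive (trunc_fourier Z) t.
Proof. eexists. apply is_derive_trunc_fourier. Qed.

Lemma trunc_fourier_even (Z t : R) : trunc_fourier Z (- t) = trunc_fourier Z t.
Proof.
  apply RInt_ext. intros z _.
  replace (- t * z) with (- (t * z)) by ring. now rewrite cos_neg.
Qed.

Lemma trunc_fourier_0 (Z : R) : trunc_fourier Z 0 = 2 * RInt gauss 0 Z.
Proof.
  rewrite <- RInt_even by (apply continuous_gauss || apply gauss_even).
  apply RInt_ext. intros z _. rewrite Rmult_0_l, cos_0. apply Rmult_1_r.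
Qed.

Lemma trunc_fourier_0_bounds (Z : R) :
  0 < Z ->
  sqrt (2 * PI) * (1 - gauss Z) <= trunc_fourier Z 0 <= sqrt (2 * PI).
Proof.
  intros HZ. rewrite trunc_fourier_0.
  assert (H := RInt_gauss_sqr Z HZ).
  assert (B := polar_remainder_bounds Z).
  assert (I0 : 0 <= RInt gauss 0 Z).
  { apply RInt_ge_0; [lra | apply ex_RInt_gauss |].
    intros; apply Rlt_le, gauss_pos. }
  assert (P := gauss_pos Z). assert (L := gauss_le_1 Z).
  assert (HPI := PI_RGT_0).
  assert (S := sqrt_pos (2 * PI)).
  assert (S2 : sqrt (2 * PI) ^ 2 = 2 * PI) by (apply pow2_sqrt; lra).
  set (s := sqrt (2 * PI)) in *.
  (* Squares are compared: the square of [2 * RInt gauss 0 Z] is [2 * PI - 4 * polar_remainder Z],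
     which lies between [2 * PI * (1 - gauss Z)] and [2 * PI]. *)
  split; (apply Rsqr_incr_0_var; [unfold Rsqr | nra]).
  - replace (s * (1 - gauss Z) * (s * (1 - gauss Z)))
      with (2 * PI * (1 - gauss Z) ^ 2) by (rewrite <- S2; ring).
    assert ((1 - gauss Z) ^ 2 <= 1 - gauss Z) by nra.
    nra.
  - replace (s * s) with (2 * PI) by (rewrite <- S2; ring).
    nra.
Qed.

(* [u = 2 t / (1 + t ^ 2)] satisfies [u' + t u >= 1], so [2 E u + s G] (with
   [E], [G] as above) times [exp (t^2/2)] is nondecreasing. *)
Lemma trunc_fourier_comparison (Z t s : R) :
  0 <= t -> s = 1 \/ s = -1 ->
  s * trunc_fourier Z 0 <=
  / gauss t * (2 * gauss Z * (2 * t / (1 + t ^ 2)) + s * trunc_fourier Z t).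
Proof.
  intros Ht Hs.
  set (W := fun t => / gauss t *
    (2 * gauss Z * (2 * t / (1 + t ^ 2)) + s * trunc_fourier Z t)).
  replace (s * trunc_fourier Z 0) with (W 0)
    by (unfold W; rewrite gauss_0; field).
  (* The fraction is [u' + t u]. The term [- t G] of [G'] cancels against the derivative of
     [/ gauss t], leaving only the sine. *)
  apply (derive_nonneg_le W (fun t => / gauss t * (2 * gauss Z *
    ((2 + 2 * t ^ 4) / (1 + t ^ 2) ^ 2 + s * sin (t * Z))))); [easy | |].
  - intros r _.
    assert (P := gauss_pos r).
    unfold W. auto_derive.
    + repeat split;
        try (apply ex_derive_gauss || apply ex_derive_trunc_fourier); nra.
    + rewrite Derive_gauss, Derive_trunc_fourier, RInt_gauss_sin.
      field. split; nra.
  - intros r _.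
    assert (P := gauss_pos r). assert (Q := gauss_pos Z).
    apply Rmult_le_pos; [now apply Rlt_le, Rinv_0_lt_compat |].
    apply Rmult_le_pos; [lra |].
    assert (1 <= (2 + 2 * r ^ 4) / (1 + r ^ 2) ^ 2).
    { apply Rle_div_r; [nra |].
      assert (0 <= (r ^ 2 - 1) ^ 2) by apply pow2_ge_0. nra. }
    assert (B := SIN_bound (r * Z)). destruct Hs; subst s; lra.
Qed.

(** For [t >= 0] the comparison with [s = 1] bounds [trunc_fourier Z t] from below and with [s = -1]
    from above, where [2 * t / (1 + t ^ 2) <= 1] and [trunc_fourier Z 0 <= sqrt (2 * PI)]. Evenness
    covers [t < 0]. *)
Lemma trunc_fourier_bounds (Z t : R) :
  0 < Z ->
  Rabs (trunc_fourier Z t) <= sqrt (2 * PI) * gauss t + 2 * gauss Z.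
Proof.
  intros HZ.
  assert (G0 := trunc_fourier_0_bounds Z HZ).
  assert (S := sqrt_pos (2 * PI)).
  assert (L := gauss_le_1 Z). assert (Q := gauss_pos Z).
  assert (Hpos : forall t, 0 <= t ->
    Rabs (trunc_fourier Z t) <= sqrt (2 * PI) * gauss t + 2 * gauss Z).
  { clear t. intros t Ht.
    assert (P := gauss_pos t).
    assert (U : 0 <= 2 * t / (1 + t ^ 2) <= 1).
    { split; [apply Rdiv_le_0_compat; nra |].
      apply Rle_div_l; [nra |]. assert (0 <= (t - 1) ^ 2) by apply pow2_ge_0.
      nra. }
    assert (C : forall s, s = 1 \/ s = -1 ->
      gauss t * (s * trunc_fourier Z 0) <= 2 * gauss Z + s * trunc_fourier Z t).
    { intros s Hs. assert (C := trunc_fourier_comparison Z t s Ht Hs).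
      apply (Rmult_le_compat_l (gauss t)) in C; [| lra].
      rewrite <- (Rmult_assoc (gauss t) (/ gauss t)), Rinv_r, Rmult_1_l in C
        by lra.
      nra. }
    assert (C1 := C 1 (or_introl eq_refl)).
    assert (C2 := C (-1) (or_intror eq_refl)).
    assert (0 <= trunc_fourier Z 0) by nra.
    assert (0 <= gauss t * (sqrt (2 * PI) - trunc_fourier Z 0))
      by (apply Rmult_le_pos; lra).
    assert (0 <= gauss t * trunc_fourier Z 0) by (apply Rmult_le_pos; lra).
    apply Rabs_le. split; lra. }
  destruct (Rle_or_lt 0 t) as [Ht | Ht]; [now apply Hpos |].
  rewrite <- trunc_fourier_even, <- gauss_even. apply Hpos. lra.
Qed.

(** * Reduction of the double integral to [trunc_fourier] *)

Lemma is_RInt_integrand (x y Z : R) :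
  is_RInt (V := C_R_NormedModule) (integrand x y) (- Z) Z
    (0, - RInt (fun z => z * gauss z * sin (x * y * z)) (- Z) Z).
Proof.
  apply (is_RInt_fct_extend_pair (U := R_NormedModule) (V := R_NormedModule)).
  - set (f := fun z => z * gauss z * cos (x * y * z)).
    assert (cf : forall z, continuous f z).
    { intros z. apply (ex_derive_continuous f). unfold f, gauss.
      auto_derive. easy. }
    (* The real part is odd in [z], so its value 0 is rewritten as the integral of [f]. *)
    rewrite <- (RInt_odd f Z cf).
    + apply (is_RInt_ext f).
      * intros z _. unfold f, integrand, cexpi, gauss. simpl.
        rewrite cos_neg. ring.
      * apply (RInt_correct (V := R_CompleteNormedModule)),
          (ex_RInt_continuous (V := R_CompleteNormedModule)).
        intros; apply cf.
    + intros z. unfold f. rewrite gauss_even.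
      replace (x * y * - z) with (- (x * y * z)) by ring.
      rewrite cos_neg. ring.
  - apply (is_RInt_ext (fun z => opp (z * gauss z * sin (x * y * z)))).
    + intros z _. unfold integrand, cexpi, gauss, opp. simpl.
      rewrite sin_neg. ring.
    + apply (is_RInt_opp (V := R_NormedModule)),
        (RInt_correct (V := R_CompleteNormedModule)), ex_RInt_gauss_sin.
Qed.

Lemma trunc_inv_eq (Y Z x : R) :
  x <> 0 ->
  trunc_inv Y Z x =
  RtoC ((trunc_fourier Z 0 - trunc_fourier Z (x * Y)) / (x * sqrt (2 * PI))).
Proof.
  intros Hx.
  assert (S : 0 < sqrt (2 * PI))
    by (apply sqrt_lt_R0; assert (H := PI_RGT_0); lra).
  unfold trunc_inv.
  erewrite (RInt_ext (V := C_R_CompleteNormedModule)).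
  2:{ intros y _.
      apply (is_RInt_unique (V := C_R_CompleteNormedModule)), is_RInt_integrand. }
  assert (H : is_RInt (fun y =>
                - RInt (fun z => z * gauss z * sin (x * y * z)) (- Z) Z) 0 Y
            (/ x * trunc_fourier Z (x * Y) - / x * trunc_fourier Z (x * 0))).
  { apply (is_RInt_derive (fun y => / x * trunc_fourier Z (x * y))).
    - intros y _. auto_derive; [apply ex_derive_trunc_fourier |].
      rewrite Derive_trunc_fourier. now field.
    - intros y _.
      (* Integration by parts expresses the integral through [trunc_fourier], whose
         differentiability gives continuity in [y]. *)
      apply continuous_ext with
        (fun y => - (x * y * trunc_fourier Z (x * y)
                     - 2 * gauss Z * sin (x * y * Z))).
      + intros r. now rewrite RInt_gauss_sin.
      + apply (ex_derive_continuous (fun y => - (x * y * trunc_fourier Z (x * y)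
                     - 2 * gauss Z * sin (x * y * Z)))).
        auto_derive. repeat split. apply ex_derive_trunc_fourier. }
  erewrite (is_RInt_unique (V := C_R_CompleteNormedModule)).
  2:{ apply (is_RInt_fct_extend_pair (U := R_NormedModule) (V := R_NormedModule)).
      - apply (is_RInt_const (V := R_NormedModule) 0 Y 0).
      - apply H. }
  (* The outer factor [Ci] turns the purely imaginary integral into a real number and reverses the
     sign of the difference. *)
  rewrite (Rmult_0_r x). unfold scal; simpl; unfold mult; simpl.
  unfold Cmult, Ci, RtoC; simpl. f_equal; field; lra.
Qed.

(** * The error estimate *)

Theorem theorem3 (kappa epsT : R) :
  1 <= kappa -> 0 < epsT < 3 * kappa ->
  let ymax := kappa * sqrt (2 * ln (3 * kappa / epsT)) in
  let zmax := sqrt (2 * ln (3 * kappa / epsT)) in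
  forall x : R, D_kappa kappa x ->
    Cmod (Cminus (trunc_inv ymax zmax x) (RtoC (/ x))) <= epsT.
Proof.
  intros Hk He ymax zmax x Hx.
  (* Positivity of the logarithm keeps [sqrt] away from its default value 0 on negative
     arguments. *)
  assert (Hln : 0 < ln (3 * kappa / epsT)).
  { rewrite <- ln_1. apply ln_increasing; [lra |]. apply Rlt_div_r; lra. }
  assert (HZ : 0 < zmax) by (apply sqrt_lt_R0; lra).
  assert (EZ : gauss zmax = epsT / (3 * kappa)).
  { unfold gauss, zmax. rewrite pow2_sqrt by lra.
    replace (- (2 * ln (3 * kappa / epsT)) / 2) with (- ln (3 * kappa / epsT))
      by field.
    rewrite exp_Ropp, exp_ln; [field; lra |]. apply Rdiv_lt_0_compat; lra. }
  assert (Hik : 0 < / kappa) by (apply Rinv_0_lt_compat; lra).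
  assert (Hax : / kappa <= Rabs x).
  { destruct Hx; [rewrite Rabs_left1 | rewrite Rabs_right]; lra. }
  assert (Hx0 : x <> 0) by (intros ->; rewrite Rabs_R0 in Hax; lra).
  (* The factor [kappa] in [ymax] compensates for [x]: [kappa * Rabs x >= 1] gives
     [Rabs (x * ymax) >= zmax]. *)
  assert (HxY : gauss (x * ymax) <= gauss zmax).
  { apply gauss_le. split; [lra |]. unfold ymax. fold zmax.
    rewrite Rabs_mult, (Rabs_right (kappa * zmax)) by nra.
    assert (kappa * / kappa = 1) by (apply Rinv_r; lra).
    assert (1 <= kappa * Rabs x) by nra. nra. }
  (* After division by [sqrt (2 * PI)], the boundary term [2 * gauss zmax] thus costs at most one
     [gauss zmax]. *)
  assert (S2 : 2 <= sqrt (2 * PI)).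
  { rewrite <- (sqrt_pow2 2) at 1 by lra. apply sqrt_le_1_alt.
    assert (H := PI2_1). lra. }
  assert (B0 := trunc_fourier_0_bounds zmax HZ).
  assert (B1 := trunc_fourier_bounds zmax (x * ymax) HZ).
  apply Rabs_le_between in B1.
  rewrite trunc_inv_eq by easy.
  rewrite <- RtoC_minus, Cmod_R.
  set (G0 := trunc_fourier zmax 0) in *.
  set (G1 := trunc_fourier zmax (x * ymax)) in *.
  set (s := sqrt (2 * PI)) in *.
  replace ((G0 - G1) / (x * s) - / x) with (/ x * ((G0 - G1 - s) * / s))
    by (field; lra).
  assert (P := gauss_pos zmax).
  rewrite Rabs_mult, Rabs_inv.
  (* [kappa] bounds [/ Rabs x]. The 3 counts one [gauss zmax] for [s - G0] and two for [G1], namely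
     its Gaussian part and its boundary term. *)
  apply Rle_trans with (kappa * (3 * gauss zmax));
    [| rewrite EZ; right; field; lra].
  apply Rmult_le_compat; try apply Rabs_pos.
  - apply Rlt_le, Rinv_0_lt_compat. lra.
  - rewrite <- (Rinv_inv kappa). apply Rinv_le_contravar; lra.
  - rewrite Rabs_mult, (Rabs_right (/ s)).
    2:{ apply Rle_ge, Rlt_le, Rinv_0_lt_compat. lra. }
    apply Rle_div_l; [lra |]. apply Rabs_le.
    assert (s * gauss (x * ymax) <= s * gauss zmax)
      by (apply Rmult_le_compat_l; lra).
    assert (2 * gauss zmax <= s * gauss zmax) by (apply Rmult_le_compat_r; lra).
    lra.
Qed.
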